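(* Let $G_\Gamma$ be a graph product of nontrivial cyclic groups $G_v$ (finite or infinite) over a finite simplicial graph $\Gamma$, and let $W_\Gamma$ be the right-angled Coxeter group obtained by replacing each vertex group by $\mathbb{Z}/2\mathbb{Z}$. Then $X_\Gamma$, with chambers the translates $gK$ ($g\in G_\Gamma$) of $K$ and with the equivalence relations described in the context, is a right-angled building of type $W_\Gamma$.
   Context: Graph product: for a finite simplicial graph $\Gamma$ with vertex set $V$ and groups $G_v$ ($v\in V$), $G_\Gamma$ is the quotient of the free product of the $G_v$ by the relations that $G_v$ and $G_w$ commute elementwise whenever $v,w$ are joined by an edge. For $T\subseteq V$, $G_T$ is the subgroup of $G_\Gamma$ generated by the $G_v$, $v\in T$; $G_\emptyset=\{1\}$. The complex $X_\Gamma$: it is the geometric realization of the poset, ordered by inclusion, of all cosets $gG_T$ with $g\in G_\Gamma$, $T\subseteq V$ and $G_T$ abelian (equivalently, $T$ spans a complete subgraph, $T=\emptyset$ allowed). $K\subset X_\Gamma$ is the geometric realization of the subposet $\{G_T\mid T\subseteq V,\ G_T \text{ abelian}\}$. $G_\Gamma$ acts on $X_\Gamma$ by left multiplication on cosets. Chamber system structure on $X_\Gamma$: let $S=\{s_v\mid v\in V\}$ be the standard generating set of $W_\Gamma$ ($s_v$ the generator of the copy of $\mathbb{Z}/2\mathbb{Z}$ at $v$). The set of chambers is $\Phi=\{gK\mid g\in G_\Gamma\}$, and $gK,hK$ are $s_v$-equivalent if $g^{-1}h\in G_v$. General definitions: a chamber system over a set $S$ is a set $\Phi$ of chambers together with a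 family of equivalence relations on $\Phi$ indexed by $S$. Two chambers are $s$-adjacent if they are $s$-equivalent but not equal. For a word $s_1\cdots s_k$ with $s_i\in S$, a gallery of type $s_1\cdots s_k$ is a sequence of chambers $\phi_0,\dots,\phi_k$ such that $\phi_{i-1}$ is $s_i$-adjacent to $\phi_i$ for each $i$. If $S$ is the generating set of a right-angled Coxeter group $W$, a $W$-valued distance function on $\Phi$ is a function $d:\Phi\times\Phi\to W$ such that, given a reduced word $s_1\cdots s_k$ representing $w\in W$, there exists a gallery of type $s_1\cdots s_k$ from $\phi$ to $\phi'$ if and only if $d(\phi,\phi')=w$. A right-angled building of type $W$ is a chamber system $\Phi$ over $S$ such that (1) for all $s\in S$, every $s$-equivalence class contains at least two chambers, and (2) there exists a $W$-valued distance function $d:\Phi\times\Phi\to W$. *)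

(* Defs.v *)
From HB Require Import structures.
From mathcomp Require Import all_boot all_order all_algebra.
From mathcomp Require Import all_classical reals.

Set Implicit Arguments.
Unset Strict Implicit.
Unset Printing Implicit Defensive.

Import Order.TTheory.

Local Open Scope classical_set_scope.
Local Open Scope group_scope.

Section Groups.
Variable H : groupType.

Definition is_subgroup (A : set H) : Prop :=
  [/\ A 1, forall x y, A x -> A y -> A (x * y) & forall x, A x -> A x^-1].

Definition generated_subgroup (A : set H) : set H := smallest is_subgroup A.

Definition abelian_subset (A : set H) : Prop :=
  forall x y, A x -> A y -> commute x y.

Definition cyclic_group : Prop :=
  exists x : H, generated_subgroup [set x] = setT.

Definition nontrivial_group : Prop := exists x : H, x <> 1.

Definition left_coset (g : H) (A : set H) : set H := [set g * x | x in A].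

Lemma left_coset1 (A : set H) : left_coset 1 A = A.
Proof.
rewrite /left_coset; apply/seteqP; split=> [_ [x Ax <-]|x Ax].
  by rewrite mul1g.
by exists x; rewrite ?mul1g.
Qed.

Lemma left_cosetM (g h : H) (A : set H) :
  left_coset (g * h) A = left_coset g (left_coset h A).
Proof.
rewrite /left_coset; apply/seteqP; split=> [_ [x Ax <-]|_ [_ [x Ax <-] <-]].
  by exists (h * x); [exists x | rewrite mulgA].
by exists x; rewrite ?mulgA.
Qed.

Lemma left_cosetS (g : H) (A B : set H) :
  A `<=` B -> left_coset g A `<=` left_coset g B.
Proof. exact: image_subset. Qed.

End Groups.

Section GraphProduct.
Variables (V : finType) (e : rel V) (G : V -> groupType).

Definition gp_word : Type := seq {v : V & G v}.

(* The first two relations present the free product of the [G v]; the third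
   one makes adjacent vertex groups commute elementwise. *)
Inductive gp_relation : gp_word -> gp_word -> Prop :=
| GpUnit v : gp_relation [:: Tagged G (1 : G v)] [::]
| GpMul v (x y : G v) :
    gp_relation [:: Tagged G x; Tagged G y] [:: Tagged G (x * y)]
| GpComm v w (x : G v) (y : G w) : e v w ->
    gp_relation [:: Tagged G x; Tagged G y] [:: Tagged G y; Tagged G x].

Inductive gp_congr : gp_word -> gp_word -> Prop :=
| GpStep r u u' s :
    gp_relation u u' -> gp_congr (r ++ u ++ s) (r ++ u' ++ s)
| GpRefl u : gp_congr u u
| GpSym u u' : gp_congr u u' -> gp_congr u' u
| GpTrans u u' u'' : gp_congr u u' -> gp_congr u' u'' -> gp_congr u u''.

Definition gp_eq (u u' : gp_word) : bool := `[< gp_congr u u' >].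

Lemma gp_eq_equiv : equiv_class_of gp_eq.
Proof.
split=> [u | u u' | u u' u''].
- by apply/asboolP; apply: GpRefl.
- by apply/asboolP/asboolP; apply: GpSym.
- by move=> /asboolP uu' /asboolP uu''; apply/asboolP/(GpTrans uu').
Qed.

Canonical gp_eq_equiv_rel := EquivRelPack gp_eq_equiv.

Definition graph_product : Type := {eq_quot gp_eq}%qT.

HB.instance Definition _ := Choice.on graph_product.
HB.instance Definition _ := Quotient.on graph_product.

Definition gp_class (u : gp_word) : graph_product := (\pi u)%qT.

Lemma gp_classP u u' : gp_class u = gp_class u' <-> gp_congr u u'.
Proof.
rewrite /gp_class; split => [/eqmodP/asboolP //| uu'].
by apply/eqmodP/asboolP.
Qed.

Lemma gp_congr_repr u : gp_congr (repr (gp_class u)) u.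
Proof. by apply/gp_classP; rewrite /gp_class reprK. Qed.

Lemma gp_congr_catl r u u' : gp_congr u u' -> gp_congr (r ++ u) (r ++ u').
Proof.
elim=> [a b b' c h|a|a b _|a b c _ h1 _ h2].
- by rewrite !(catA r); apply: GpStep.
- exact: GpRefl.
- exact: GpSym.
- exact: GpTrans h1 h2.
Qed.

Lemma gp_congr_catr s u u' : gp_congr u u' -> gp_congr (u ++ s) (u' ++ s).
Proof.
elim=> [a b b' c h|a|a b _|a b c _ h1 _ h2].
- by rewrite -!catA; apply: GpStep.
- exact: GpRefl.
- exact: GpSym.
- exact: GpTrans h1 h2.
Qed.

Lemma gp_congr_cat u u' t t' :
  gp_congr u u' -> gp_congr t t' -> gp_congr (u ++ t) (u' ++ t').
Proof.
by move=> uu' tt'; apply: GpTrans (gp_congr_catr _ uu') (gp_congr_catl _ tt').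
Qed.

Definition gp_inv_word (u : gp_word) : gp_word :=
  rev [seq let: existT v x := p in Tagged G (x : G v)^-1 | p <- u].

Lemma gp_inv_word_cat u t :
  gp_inv_word (u ++ t) = gp_inv_word t ++ gp_inv_word u.
Proof. by rewrite /gp_inv_word map_cat rev_cat. Qed.

Lemma gp_inv_wordK : involutive gp_inv_word.
Proof.
move=> u; rewrite /gp_inv_word map_rev revK -map_comp.
by apply: map_id_in => -[v x] _ /=; rewrite invgK.
Qed.

Lemma gp_congr_inv u u' :
  gp_congr u u' -> gp_congr (gp_inv_word u) (gp_inv_word u').
Proof.
elim=> [a b b' c h|a|a b _|a b c _ h1 _ h2].
- rewrite !gp_inv_word_cat -!catA.
  apply/gp_congr_catl/gp_congr_catr.
  case: h => [v|v x y|v w x y evw]; rewrite /gp_inv_word /rev /=.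
  + by rewrite invg1; apply: (GpStep [::] [::] (GpUnit v)).
  + by rewrite invgM; apply: (GpStep [::] [::] (GpMul y^-1 x^-1)).
  + apply: GpSym.
    exact: (GpStep [::] [::] (GpComm x^-1 y^-1 evw)).
- exact: GpRefl.
- exact: GpSym.
- exact: GpTrans h1 h2.
Qed.

Lemma gp_congr_mulV u : gp_congr (gp_inv_word u ++ u) [::].
Proof.
elim: u => [|[v x] u IHu]; first exact: GpRefl.
rewrite -cat1s gp_inv_word_cat -catA (catA _ [:: _] u).
apply: GpTrans IHu; apply: gp_congr_catl.
apply: (@gp_congr_catr u _ [::]).
apply: GpTrans (GpStep [::] [::] (GpUnit v)).
have := GpStep [::] [::] (GpMul x^-1 x).
by rewrite mulVg.
Qed.

Definition gp_one : graph_product := gp_class [::].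
Definition gp_mul (a b : graph_product) : graph_product :=
  gp_class (repr a ++ repr b).
Definition gp_inv (a : graph_product) : graph_product :=
  gp_class (gp_inv_word (repr a)).

Lemma gp_class_mul u t : gp_mul (gp_class u) (gp_class t) = gp_class (u ++ t).
Proof. by apply/gp_classP/gp_congr_cat; apply: gp_congr_repr. Qed.

Lemma gp_class_inv u : gp_inv (gp_class u) = gp_class (gp_inv_word u).
Proof. by apply/gp_classP/gp_congr_inv/gp_congr_repr. Qed.

Lemma gp_classW (P : graph_product -> Prop) :
  (forall u, P (gp_class u)) -> forall a, P a.
Proof. by move=> Pu a; rewrite -(reprK a). Qed.

Lemma gp_mulA : associative gp_mul.
Proof.
by elim/gp_classW=> u; elim/gp_classW=> t; elim/gp_classW=> s;
  rewrite !gp_class_mul catA.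
Qed.

Lemma gp_mul1 : left_id gp_one gp_mul.
Proof. by elim/gp_classW=> u; rewrite gp_class_mul. Qed.

Lemma gp_mulr1 : right_id gp_one gp_mul.
Proof. by elim/gp_classW=> u; rewrite gp_class_mul cats0. Qed.

Lemma gp_mulVg : left_inverse gp_one gp_inv gp_mul.
Proof.
elim/gp_classW=> u; rewrite gp_class_inv gp_class_mul.
by apply/gp_classP/gp_congr_mulV.
Qed.

Lemma gp_mulgV : right_inverse gp_one gp_inv gp_mul.
Proof.
elim/gp_classW=> u; rewrite gp_class_inv gp_class_mul.
apply/gp_classP; rewrite -{1}(gp_inv_wordK u).
exact: gp_congr_mulV.
Qed.

HB.instance Definition _ := isGroup.Build graph_product
  gp_mulA gp_mul1 gp_mulr1 gp_mulVg gp_mulgV.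

Definition gp_inj (v : V) (x : G v) : graph_product :=
  gp_class [:: Tagged G x].

Definition vertex_subgroup (v : V) : set graph_product := range (@gp_inj v).

Definition special_subgroup (T : {set V}) : set graph_product :=
  generated_subgroup (\bigcup_(v in [set v | v \in T]) vertex_subgroup v).

End GraphProduct.

Arguments vertex_subgroup {V} e G v _.
Arguments special_subgroup {V} e G T _.

(* ['Z_2] is written additively as a ring; as a [groupType] its product is
   addition modulo 2, so it is the group of order 2. *)
Definition racg (V : finType) (e : rel V) : groupType :=
  graph_product e (fun=> 'Z_2 : groupType).

Definition racg_gen (V : finType) (e : rel V) (v : V) : racg e :=
  gp_inj e (G := fun=> 'Z_2 : groupType) (v := v) (1%R : 'Z_2).

(* A point of the geometric realization of a poset is given by its barycentric
   coordinates: a convex combination of the elements of a finite chain. *)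
Section Realization.
Local Open Scope ring_scope.
Variables (R : realType) (d : Order.disp_t) (P : porderType d).

Definition weight_support (f : P -> R) : set P := [set p | f p != 0].

Record realization : Type := Realization {
  weight : P -> R;
  weight_ge0 : forall p, 0 <= weight p;
  weight_finite : finite_set (weight_support weight);
  weight_chain : total_on (weight_support weight) (fun p q => (p <= q)%O);
  weight_sum : \sum_(p \in weight_support weight) weight p = 1
}.

(* The realization of a subposet, as a subcomplex. *)
Definition subrealization (Q : set P) : set realization :=
  [set x | weight_support (weight x) `<=` Q].

Section Map.
Variables f f' : P -> P.
Hypotheses (fK : cancel f f') (f'K : cancel f' f).
Hypothesis f_homo : {homo f : p q / (p <= q)%O}.
Variable x : realization.

Lemma weight_support_map :
  weight_support (weight x \o f') = f @` weight_support (weight x).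
Proof.
apply/seteqP; split=> [p xp|_ [p xp <-]] /=.
  by exists (f' p).
by rewrite /weight_support /= fK.
Qed.

Lemma realization_map_ge0 p : 0 <= (weight x \o f') p.
Proof. exact: weight_ge0. Qed.

Lemma realization_map_finite : finite_set (weight_support (weight x \o f')).
Proof. by rewrite weight_support_map; apply/finite_image/weight_finite. Qed.

Lemma realization_map_chain :
  total_on (weight_support (weight x \o f')) (fun p q => (p <= q)%O).
Proof.
rewrite weight_support_map => _ _ [p xp <-] [q xq <-].
by have [/f_homo|/f_homo] := weight_chain xp xq; [left|right].
Qed.

Lemma realization_map_sum :
  \sum_(p \in weight_support (weight x \o f')) (weight x \o f') p = 1.
Proof.
rewrite weight_support_map -(weight_sum x).
rewrite (reindex_fsbig f (weight_support (weight x))).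
  by apply: eq_fsbigr => p _ /=; rewrite fK.
split=> [p xp|p q _ _|q]; [by exists p | exact: (can_inj fK) |].
by [].
Qed.

(* The map induced by an order automorphism [f] with inverse [f']. *)
Definition realization_map : realization :=
  Realization realization_map_ge0 realization_map_finite
    realization_map_chain realization_map_sum.

End Map.
End Realization.

Section Complex.
Variables (R : realType) (V : finType) (e : rel V) (G : V -> groupType).
Let GG : groupType := graph_product e G.

Definition abelian_cosets : set (set GG) :=
  [set A | exists g (T : {set V}), abelian_subset (special_subgroup e G T) /\
     A = left_coset g (special_subgroup e G T)].

Definition coset_poset : Type := abelian_cosets.

HB.instance Definition _ := SubChoice.on coset_poset.
HB.instance Definition _ :=
  [SubChoice_isSubPOrder of coset_poset by <: with set_display].

Lemma coset_poset_leP (A B : coset_poset) :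
  (A <= B)%O <-> (val A `<=` val B).
Proof. by rewrite -subsetEset Order.le_val. Qed.

Lemma translate_coset_subproof (g : GG) (A : coset_poset) :
  left_coset g (val A) \in abelian_cosets.
Proof.
case: A => A /= /set_mem[h [T [abT ->]]]; apply/mem_set.
by exists (g * h), T; rewrite left_cosetM.
Qed.

Definition translate_coset (g : GG) (A : coset_poset) : coset_poset :=
  exist _ (left_coset g (val A)) (translate_coset_subproof g A).

Lemma translate_cosetK (g : GG) :
  cancel (translate_coset g) (translate_coset g^-1).
Proof.
by move=> A; apply: val_inj; rewrite /= -left_cosetM mulVg left_coset1.
Qed.

Lemma translate_cosetKV (g : GG) :
  cancel (translate_coset g^-1) (translate_coset g).
Proof. by move=> A; rewrite -{1}(invgK g) translate_cosetK. Qed.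

Lemma translate_coset_homo (g : GG) :
  {homo translate_coset g : A B / (A <= B)%O}.
Proof.
move=> A B /coset_poset_leP AB; apply/coset_poset_leP.
exact: left_cosetS.
Qed.

Definition complexX : Type := realization R coset_poset.

Definition translate (g : GG) : complexX -> complexX :=
  realization_map (translate_cosetK g) (translate_cosetKV g)
    (@translate_coset_homo g).

Definition complexK : set complexX :=
  subrealization [set A : coset_poset | exists T : {set V},
    abelian_subset (special_subgroup e G T) /\
    val A = special_subgroup e G T].

Definition translateK (g : GG) : set complexX := translate g @` complexK.

End Complex.

Arguments complexX R {V} e G.
Arguments translateK R {V} e G g _.

(* Only the data of a chamber system; the axiom that the relations are
   equivalence relations is [is_chamber_system]. *)
Record prechamber_system (S : Type) : Type := PrechamberSystem {
  chamber : Type;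
  chamber_equiv : S -> chamber -> chamber -> Prop
}.

Definition is_chamber_system (S : Type) (C : prechamber_system S) : Prop :=
  forall s, RelationClasses.Equivalence (@chamber_equiv S C s).

Section Building.
Variables (S : Type) (C : prechamber_system S).

Definition chamber_adjacent (s : S) (x y : chamber C) : Prop :=
  chamber_equiv s x y /\ x <> y.

(* [x :: p] is a gallery of type [w]. *)
Fixpoint is_gallery (w : seq S) (x : chamber C) (p : seq (chamber C)) : Prop :=
  match w, p with
  | [::], [::] => True
  | s :: w', y :: p' => chamber_adjacent s x y /\ is_gallery w' y p'
  | _, _ => False
  end.

Definition gallery_from_to (w : seq S) (x y : chamber C) : Prop :=
  exists p, is_gallery w x p /\ last x p = y.

(* Here [gen] enumerates a generating set of [W]. *)
Variables (W : groupType) (gen : S -> W).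

Definition word_value (w : seq S) : W := \prod_(s <- w) gen s.

Definition reduced_word (w : seq S) : Prop :=
  forall w', word_value w' = word_value w -> (size w <= size w')%N.

Definition is_distance (delta : chamber C -> chamber C -> W) : Prop :=
  forall w, reduced_word w ->
  forall x y, gallery_from_to w x y <-> delta x y = word_value w.

End Building.

(* Chamber systems are indexed by [V] rather than by the set of standard
   generators: [v |-> racg_gen e v] identifies the two. *)
Definition right_angled_building (V : finType) (e : rel V)
    (C : prechamber_system V) : Prop :=
  [/\ is_chamber_system C,
      forall (v : V) (x : chamber C), exists y z : chamber C,
        [/\ chamber_equiv v x y, chamber_equiv v x z & y <> z]
    & exists delta : chamber C -> chamber C -> racg e,
        is_distance (racg_gen e) delta].

Definition building_system (R : realType) (V : finType) (e : rel V)
    (G : V -> groupType) : prechamber_system V :=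
  @PrechamberSystem V (range (translateK R e G))
    (fun v C D => exists g h : graph_product e G,
       [/\ val C = translateK R e G g, val D = translateK R e G h
         & vertex_subgroup e G v (g^-1 * h)]).

(* Main.v *)
(* The translate [gK] contains the vertex [gG_0 = {g}], and every vertex of [hK]
   is a coset containing [h]; hence [gK = hK] forces [g = h], and chambers are
   the elements of the graph product.

   Galleries of type [v1 ... vk] starting at [g] then correspond to expressions
   [x1 ... xk] with [xi] nontrivial in [G_vi].  By Green's normal form theorem
   two reduced expressions of the same element differ by swaps of commuting
   neighbours.  It is proved by letting each [G_v] act on reduced words modulo
   such swaps (multiply into the [v]-syllable that can be moved to the front, or
   create one).  Being reduced depends only on the sequence of vertices, so the
   theorem for [W_Gamma] identifies the vertex sequences of reduced expressions
   with the reduced words of [W_Gamma], and the distance from [g] to [h] is the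
   element of [W_Gamma] spelled by a reduced expression of [g^-1 h]. *)

Require Import Defs.
From mathcomp Require Import all_boot all_order all_algebra.
From mathcomp Require Import all_classical reals.

Set Implicit Arguments.
Unset Strict Implicit.
Unset Printing Implicit Defensive.

Local Open Scope group_scope.

(** * Words up to swaps of neighbouring letters *)

Section Shuffle.
Variables (T : Type) (r : rel T).

Inductive shuffle : seq T -> seq T -> Prop :=
| ShuffleRefl s : shuffle s s
| ShuffleSwap a b s : r a b -> shuffle [:: a, b & s] [:: b, a & s]
| ShuffleCons a s t : shuffle s t -> shuffle (a :: s) (a :: t)
| ShuffleTrans s t u : shuffle s t -> shuffle t u -> shuffle s u.

Lemma shuffle_sym : symmetric r -> forall s t, shuffle s t -> shuffle t s.
Proof.
move=> r_sym s t; elim=> {s t} [s|a b s rab|a s t _ IH|s t u _ IH1 _ IH2].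
- exact: ShuffleRefl.
- by apply: ShuffleSwap; rewrite r_sym.
- exact: ShuffleCons.
- exact: ShuffleTrans IH2 IH1.
Qed.

Lemma shuffle_size s t : shuffle s t -> size s = size t.
Proof.
by elim=> {s t} [|a b s _|a s t _ /= ->|s t u _ -> _ ->].
Qed.

Lemma shuffle_all (a : pred T) s t : shuffle s t -> all a s = all a t.
Proof.
elim=> {s t} [//|b c s _|b s t _ /= ->|s t u _ -> _ ->] //=.
by rewrite andbCA.
Qed.

End Shuffle.

Lemma shuffle_map (T T' : Type) (r : rel T) (r' : rel T') (f : T -> T') :
  (forall a b, r a b -> r' (f a) (f b)) ->
  forall s t, shuffle r s t -> shuffle r' (map f s) (map f t).
Proof.
move=> rf s t; elim=> {s t} [s|a b s rab|a s t _ IH|s t u _ IH1 _ IH2] /=.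
- exact: ShuffleRefl.
- by apply: ShuffleSwap; apply: rf.
- exact: ShuffleCons.
- exact: ShuffleTrans IH1 IH2.
Qed.

(** * Reducedness of vertex sequences *)

Section TypeWords.
Variables (V : finType) (e : rel V).

(* No occurrence of [v] in [t] can be moved to the front by swapping
   adjacent letters. *)
Fixpoint head_free (v : V) (t : seq V) : bool :=
  if t is w :: t' then (v != w) && (e v w ==> head_free v t') else true.

(** For words of nontrivial syllables this is Green's condition: no two syllables at one vertex can
    be brought side by side by swaps. *)
Fixpoint graph_reduced (t : seq V) : bool :=
  if t is v :: t' then head_free v t' && graph_reduced t' else true.

End TypeWords.

(** * Green's normal form, from letters acting on reduced words *)

Section NormalForm.
Variables (V : finType) (e : rel V) (G : V -> groupType).
Hypotheses (e_sym : symmetric e) (e_irr : irreflexive e).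

Local Notation word := (gp_word G).
Local Notation letter := {v : V & G v}.
Local Notation types := (map (@tag V G)).

Definition commuting : rel letter := fun p q => e (tag p) (tag q).

Local Notation "s ~ t" := (shuffle commuting s t) (at level 70).

Definition trivial_letter (p : letter) : bool := tagged p == 1.

Definition reduced (u : word) : bool :=
  all (predC trivial_letter) u && graph_reduced e (types u).

(* The product of [head_part v u] and [tail_part v u] is [u]: the first
   occurrence of [v] is moved to the front if all letters before it commute
   with [v]; otherwise [head_part v u = 1]. *)
Fixpoint head_part (v : V) (u : word) : G v :=
  if u is p :: u' then
    if v == tag p then tagged_as (Tagged G (1 : G v)) p
    else if e v (tag p) then head_part v u' else 1
  else 1.

Fixpoint tail_part (v : V) (u : word) : word :=
  if u is p :: u' then
    if v == tag p then u'
    else if e v (tag p) then p :: tail_part v u' else u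
  else [::].

Definition push (v : V) (x : G v) (u : word) : word :=
  if x == 1 then u else Tagged G x :: u.

Definition act_letter (p : letter) (u : word) : word :=
  push (tagged p * head_part (tag p) u) (tail_part (tag p) u).

Definition normal_form (u : word) : word := foldr act_letter [::] u.

Lemma head_part_here v (x : G v) u : head_part v (Tagged G x :: u) = x.
Proof. by rewrite /= eqxx (tagged_asE (u := Tagged G (1 : G v))). Qed.

Lemma adj_neq v w : e v w -> (v == w) = false.
Proof. by case: eqP => // ->; rewrite e_irr. Qed.

Lemma head_part_free v u : head_free e v (types u) -> head_part v u = 1.
Proof.
by elim: u => //= p u IH /andP[/negbTE-> /implyP h]; case: ifP => // /h.
Qed.

Lemma tail_part_free v u : head_free e v (types u) -> tail_part v u = u.
Proof.
by elim: u => //= p u IH /andP[/negbTE-> /implyP h]; case: ifP => // /h/IH->.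
Qed.

(** The deleted [v]-syllable commutes with [w], so it was not what blocked [w]. *)
Lemma head_free_tail v w u : e v w ->
  head_free e w (types u) -> head_free e w (types (tail_part v u)).
Proof.
move=> evw; elim: u => //= p u IH /andP[wp /implyP h].
case: eqVneq => [vp|vp]; first by apply: h; rewrite -vp e_sym.
by case: ifP => _ /=; rewrite wp; apply/implyP=> /h // /IH.
Qed.

(** A second [v]-syllable reachable once the first is gone would contradict reducedness of [u]. *)
Lemma reduced_tail v u : reduced u ->
  reduced (tail_part v u) && head_free e v (types (tail_part v u)).
Proof.
rewrite /reduced; elim: u => //= p u IH /andP[/andP[p1 u1] /andP[fp ru]].
case: eqVneq => [->|vp]; first by rewrite u1 ru fp.
have /andP[/andP[t1 rt] ft] := IH (introT andP (conj u1 ru)).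
case: ifP => [ep|ep] /=; last by rewrite p1 u1 fp ru vp ep.
by rewrite p1 t1 rt vp ft implybT !andbT /= head_free_tail.
Qed.

Lemma reduced_push v (x : G v) u :
  reduced u -> head_free e v (types u) -> reduced (push x u).
Proof.
rewrite /push /reduced => /andP[u1 ru] fu.
by case: ifPn => [_|x1] /=; rewrite u1 ru //= fu /trivial_letter x1.
Qed.

Lemma reduced_act p u : reduced u -> reduced (act_letter p u).
Proof. by move=> /(reduced_tail (tag p)) /andP[? ?]; apply: reduced_push. Qed.

Lemma reduced_normal_form u : reduced (normal_form u).
Proof. by elim: u => //= p u; apply: reduced_act. Qed.

Lemma normal_form_id u : reduced u -> normal_form u = u.
Proof.
rewrite /reduced; elim: u => //= -[v x] u IH.
move=> /andP[/andP[x1 u1] /andP[fu ru]]; rewrite IH ?u1 //.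
rewrite /act_letter head_part_free // tail_part_free //= mulg1.
by rewrite /push; move: x1; rewrite /trivial_letter /= => /negbTE ->.
Qed.

Lemma push_shuffle v (x : G v) u u' : u ~ u' -> push x u ~ push x u'.
Proof. by rewrite /push; case: ifP => // _; apply: ShuffleCons. Qed.

Lemma push_head_tail v u : reduced u ->
  push (head_part v u) (tail_part v u) ~ u.
Proof.
rewrite /push /reduced; elim: u => [_|[w x] u IH] /=.
  by rewrite eqxx; apply: ShuffleRefl.
move=> /andP[/andP[x1 u1] /andP[fu ru]].
case: (eqVneq v w) => [vw|vw].
  subst w; rewrite (tagged_asE (u := Tagged G (1 : G v))).
  by move: x1; rewrite /trivial_letter /= => /negbTE ->; apply: ShuffleRefl.
have [evw|_] := boolP (e v w); last by rewrite eqxx; apply: ShuffleRefl.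
move: IH; rewrite u1 ru => /(_ isT).
case: ifP => _ IH; first exact: ShuffleCons.
by apply: ShuffleTrans (ShuffleCons _ IH); apply: ShuffleSwap.
Qed.

(** Makes the action well defined modulo swaps. Since [e] is irreflexive, a swap never exchanges two
    syllables at one vertex, so the reachable [v]-syllable stays the same. *)
Lemma shuffle_head_tail v u u' : u ~ u' ->
  head_part v u = head_part v u' /\ tail_part v u ~ tail_part v u'.
Proof.
elim=> {u u'} [u|[a x] [b y] u eab|p u u' uu' [IH1 IH2]|
               u u' u'' _ [h1 t1] _ [h2 t2]] /=.
- by split=> //; apply: ShuffleRefl.
- rewrite /commuting /= in eab; have eba : e b a by rewrite e_sym.
  case: (eqVneq v a) => [va|va].
    subst a; rewrite (adj_neq eab) eab.
    by split=> //; apply: ShuffleRefl.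
  case: (eqVneq v b) => [vb|vb].
    subst b; rewrite eba; split=> //; apply: ShuffleRefl.
  case: (e v a); case: (e v b) => /=; split=> //; do ?exact: ShuffleRefl;
    exact: ShuffleSwap.
- case: ifP => _ //; case: ifP => _; split=> //; exact: ShuffleCons.
- by split; [rewrite h1 | apply: ShuffleTrans t1 t2].
Qed.

Lemma act_shuffle p u u' : u ~ u' -> act_letter p u ~ act_letter p u'.
Proof.
move=> /(shuffle_head_tail (tag p)) [h t].
by rewrite /act_letter h; apply: push_shuffle.
Qed.

Lemma head_tail_push v (x : G v) u : head_free e v (types u) ->
  head_part v (push x u) = x /\ tail_part v (push x u) = u.
Proof.
rewrite /push => fu; case: (eqVneq x 1) => [->|_].
  by rewrite head_part_free ?tail_part_free.
by rewrite head_part_here /= eqxx.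
Qed.

(** Equality holds without swaps: no [v]-syllable is reachable in the tail, so [x] multiplies
    exactly what [y] pushed. *)
Lemma act_mul v (x y : G v) u : reduced u ->
  act_letter (Tagged G x) (act_letter (Tagged G y) u) =
  act_letter (Tagged G (x * y)) u.
Proof.
move=> /(reduced_tail v) /andP[_ fu]; rewrite /act_letter /=.
by have [-> ->] := head_tail_push (y * head_part v u) fu; rewrite mulgA.
Qed.

Lemma head_part_push v w (x : G w) u : e v w ->
  head_part v (push x u) = head_part v u.
Proof. by rewrite /push; case: ifP => //= _ h; rewrite adj_neq // h. Qed.

Lemma tail_part_push v w (x : G w) u : e v w ->
  tail_part v (push x u) = push x (tail_part v u).
Proof. by rewrite /push; case: ifP => //= _ h; rewrite adj_neq // h. Qed.

Lemma head_part_tail v w u : e v w ->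
  head_part v (tail_part w u) = head_part v u.
Proof.
move=> evw; elim: u => //= p u IH.
case: (eqVneq w (tag p)) => [<-|wp]; first by rewrite adj_neq // evw.
by case: ifP => //= _; rewrite IH.
Qed.

Lemma tail_part_comm v w u : e v w ->
  tail_part v (tail_part w u) = tail_part w (tail_part v u).
Proof.
move=> evw; have ewv : e w v by rewrite e_sym.
elim: u => //= p u IH.
case: (eqVneq w (tag p)) => [wp|wp].
  by subst w; rewrite (adj_neq evw) evw /= eqxx.
case: (eqVneq v (tag p)) => [vp|vp].
  by subst v; rewrite ewv /= eqxx.
have [ewp|ewp] := boolP (e w (tag p)); have [evp|evp] := boolP (e v (tag p));
  rewrite /= ?(negbTE vp) ?(negbTE wp) ?ewp ?evp ?(negbTE ewp) ?(negbTE evp) //.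
by rewrite IH.
Qed.

Lemma push_comm v w (x : G v) (y : G w) u : e v w ->
  push x (push y u) ~ push y (push x u).
Proof.
move=> evw; rewrite /push; case: ifP => _; case: ifP => _;
  by [apply: ShuffleRefl | apply: ShuffleSwap].
Qed.

(** Extractions at adjacent vertices do not interfere; only the order of the two final pushes
    differs. *)
Lemma act_comm v w (x : G v) (y : G w) u : e v w ->
  act_letter (Tagged G x) (act_letter (Tagged G y) u) ~
  act_letter (Tagged G y) (act_letter (Tagged G x) u).
Proof.
move=> evw; have ewv : e w v by rewrite e_sym.
rewrite /act_letter /= !head_part_push // !tail_part_push //.
rewrite !head_part_tail // (tail_part_comm _ evw).
exact: push_comm.
Qed.

Lemma foldr_act_shuffle r u u' :
  u ~ u' -> foldr act_letter u r ~ foldr act_letter u' r.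
Proof. by move=> uu'; elim: r => //= p r; apply: act_shuffle. Qed.

(** The action respects the three defining relations up to swaps. Reduced words being their own
    normal forms, uniqueness of reduced expressions follows. *)
Lemma normal_form_congr u u' :
  gp_congr e u u' -> normal_form u ~ normal_form u'.
Proof.
elim=> {u u'} [r a a' s aa'|u|u u' _|u u' u'' _ h1 _ h2].
- rewrite /normal_form !foldr_cat -/(normal_form s).
  apply: foldr_act_shuffle; have rs := reduced_normal_form s.
  case: aa' => [v|v x y|v w x y evw] /=.
  (* The trivial letter extracts a syllable and puts it back. *)
  + by rewrite /act_letter /= mul1g; apply: push_head_tail.
  + by rewrite act_mul //; apply: ShuffleRefl.
  + exact: act_comm.
- exact: ShuffleRefl.
- by apply: shuffle_sym => p q; apply: e_sym.
- exact: ShuffleTrans h1 h2.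
Qed.

Lemma reduced_word_unique u u' :
  reduced u -> reduced u' -> gp_congr e u u' -> u ~ u'.
Proof.
by move=> ru ru' /normal_form_congr; rewrite !normal_form_id.
Qed.

Lemma shuffle_congr u u' : u ~ u' -> gp_congr e u u'.
Proof.
elim=> {u u'} [u|[a x] [b y] u /= eab|p u u' _ IH|u u' u'' _ IH1 _ IH2].
- exact: GpRefl.
- exact: (GpStep [::] u (GpComm x y eab)).
- exact: (gp_congr_catl [:: p] IH).
- exact: GpTrans IH1 IH2.
Qed.

Lemma push_congr v (x : G v) u : gp_congr e (push x u) (Tagged G x :: u).
Proof.
rewrite /push; case: (eqVneq x 1) => [->|_]; last exact: GpRefl.
by apply: GpSym; apply: (GpStep [::] u (GpUnit e G v)).
Qed.

Lemma act_congr p u : reduced u -> gp_congr e (act_letter p u) (p :: u).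
Proof.
case: p => v x ru; apply: GpTrans (push_congr _ _) _ => /=.
apply: GpTrans (gp_congr_catl [:: _] (shuffle_congr (push_head_tail v ru))).
apply: GpTrans (gp_congr_catl [:: _] (GpSym (push_congr _ _))).
by apply: GpSym; apply: (GpStep [::] _ (GpMul _ _ _)).
Qed.

Lemma congr_normal_form u : gp_congr e (normal_form u) u.
Proof.
elim: u => [|p u IH] /=; first exact: GpRefl.
apply: GpTrans (act_congr _ (reduced_normal_form u)) _.
exact: (gp_congr_catl [:: p] IH).
Qed.

(** * Lengths of normal forms *)

Lemma size_tail_part v u :
  size (tail_part v u) <= size u ?= iff head_free e v (types u).
Proof.
elim: u => [|p u IH]; first exact/leqif_refl.
rewrite /=; case: (eqVneq v (tag p)) => [_|_] /=; first exact/leqifP.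
case: (e v (tag p)) => /=; last exact/leqif_refl.
by move: IH; rewrite /leqif eqSS ltnS.
Qed.

Lemma size_push v (x : G v) u : size (push x u) = (x != 1) + size u.
Proof. by rewrite /push; case: ifP. Qed.

Lemma size_normal_form u : size (normal_form u) <= size u.
Proof.
elim: u => //= p u IH; rewrite size_push.
apply: leq_add (leq_b1 _) (leq_trans _ IH).
exact: (size_tail_part _ _).1.
Qed.

(** If no length is lost, every letter was prepended without merging or cancelling. This serves to
    show that shortest words are reduced. *)
Lemma normal_form_full_size u :
  size (normal_form u) = size u -> normal_form u = u.
Proof.
elim: u => //= p u IH; rewrite /act_letter size_push => size_pu.
have le_tail := size_tail_part (tag p) (normal_form u).
have le_nf := size_normal_form u.
(* One letter adds at most one to the length, so none was lost in [u] either. *)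
have size_nf : size (normal_form u) = size u.
  apply/eqP; rewrite eqn_leq le_nf -ltnS -size_pu -add1n.
  exact: leq_add (leq_b1 _) le_tail.1.
move: size_pu le_tail; rewrite (IH size_nf) => size_pu le_tail.
(* The push adds at most one letter, so the tail kept its full length and nothing was extracted. *)
have fu : head_free e (tag p) (types u).
  rewrite -(geq_leqif le_tail) -ltnS -size_pu -add1n.
  by rewrite leq_add2r leq_b1.
move: size_pu; rewrite (tail_part_free fu) (head_part_free fu) mulg1 /push.
by case: (eqVneq (tagged p) 1) => [_ /n_Sn//|_ _]; case: p {le_tail fu}.
Qed.

End NormalForm.

(** * Reduced words of the Coxeter group, as the case of vertex groups of order two *)

Section Coxeter.
Variables (V : finType) (e : rel V).
Hypotheses (e_sym : symmetric e) (e_irr : irreflexive e).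

Local Notation Z2 := (fun _ : V => 'Z_2 : groupType).

Definition racg_word (t : seq V) : gp_word Z2 :=
  [seq existT Z2 v (1%R : 'Z_2) | v <- t].

Lemma racg_wordK : cancel racg_word (map (@tag V Z2)).
Proof. by move=> t; rewrite -map_comp map_id. Qed.

Lemma racg_word_types (u : gp_word Z2) :
  all (predC (@trivial_letter V Z2)) u -> racg_word (map (@tag V Z2) u) = u.
Proof.
elim: u => //= -[v x] u IH /= /andP[x1 /IH->]; congr (_ :: _).
(* The bound on elements of ['Z_2] leaves 1 as the only nontrivial one. *)
by case: x x1 => [[|[|]]] //= i _; congr existT; apply: val_inj.
Qed.

Lemma reduced_racg_word t : reduced e (racg_word t) = graph_reduced e t.
Proof.
rewrite /reduced racg_wordK.
by suff -> : all (predC (@trivial_letter V Z2)) (racg_word t) by []; elim: t.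
Qed.

Lemma word_value_racg t : word_value (racg_gen e) t = gp_class e (racg_word t).
Proof.
rewrite /word_value; elim: t => [|v t IH]; first by rewrite big_nil.
by rewrite big_cons IH; apply: gp_class_mul.
Qed.

Lemma shuffle_word_value t t' :
  shuffle e t t' -> word_value (racg_gen e) t = word_value (racg_gen e) t'.
Proof.
move=> tt'; rewrite !word_value_racg; apply/gp_classP/shuffle_congr.
exact: (shuffle_map (f := fun v => existT Z2 v (1%R : 'Z_2)) _ tt').
Qed.

Lemma graph_reduced_shuffle t t' : graph_reduced e t -> graph_reduced e t' ->
  word_value (racg_gen e) t = word_value (racg_gen e) t' -> shuffle e t t'.
Proof.
rewrite -!reduced_racg_word !word_value_racg => rt rt' /gp_classP.
move=> /(reduced_word_unique e_sym e_irr rt rt').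
rewrite -{2}(racg_wordK t) -{2}(racg_wordK t').
exact: shuffle_map.
Qed.

(** Normal forms are never longer than the word, and swaps preserve length. Hence a minimal word
    equals its normal form, and a graph-reduced one is as short as any word with its value. *)
Lemma reduced_wordP t : reduced_word (racg_gen e) t <-> graph_reduced e t.
Proof.
split=> [min_t|rt t'].
  have rn := reduced_normal_form e_sym (racg_word t).
  set n := normal_form _ _ in rn.
  have nE : racg_word (map (@tag V Z2) n) = n.
    by apply: racg_word_types; case/andP: rn.
  rewrite -reduced_racg_word -(@normal_form_full_size _ e _ (racg_word t)) //.
  apply/eqP; rewrite eqn_leq size_normal_form /= [size (racg_word t)]size_map.
  rewrite -/n -(size_map (@tag V Z2) n); apply: min_t.
  rewrite !word_value_racg nE; apply/gp_classP.
  exact: congr_normal_form.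
rewrite !word_value_racg => /gp_classP.
move=> /(normal_form_congr e_sym e_irr) /shuffle_size.
rewrite (normal_form_id (u := racg_word t)) ?reduced_racg_word //.
rewrite [size (racg_word t)]size_map => <-.
by rewrite -(size_map (fun v => existT Z2 v (1%R : 'Z_2)) t') size_normal_form.
Qed.

End Coxeter.

(** * Lifting swaps from types to syllables *)

Section ShuffleTypes.
Variables (V : finType) (e : rel V) (G : V -> groupType).

(** Commutation of syllables depends only on their vertices, so swaps lift one by one. This turns an
    expression into one of any type equivalent to its own. *)
Lemma shuffle_types_lift (u : gp_word G) t :
  shuffle e (map (@tag V G) u) t ->
  exists2 u', shuffle (commuting e (G := G)) u u' & map (@tag V G) u' = t.
Proof.
move tE: (map _ u) => s st; elim: st u tE => {s t}.
- by move=> s u <-; exists u => //; apply: ShuffleRefl.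
- move=> a b s eab [|p [|q u]] //= [pa qb <-].
  exists [:: q, p & u]; last by rewrite /= pa qb.
  by apply: ShuffleSwap; rewrite /commuting pa qb.
- move=> a s t _ IH [|p u] //= [pa /IH[u' uu' <-]].
  by exists (p :: u'); [apply: ShuffleCons | rewrite /= pa].
- move=> s t t' _ IH1 _ IH2 u /IH1[u1 uu1 /IH2[u2 u12 <-]].
  by exists u2 => //; apply: ShuffleTrans uu1 u12.
Qed.

End ShuffleTypes.

(** * The vertex of the complex at the identity *)

Section Chambers.
Variables (V : finType) (e : rel V) (G : V -> groupType).
Local Open Scope classical_set_scope.

Lemma special_subgroup0 : special_subgroup e G finset.set0 = [set 1].
Proof.
apply/seteqP; split=> [x|_ ->].
  apply; split=> [|y [v]]; last by rewrite /= finset.inE.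
  by split=> [//|y z -> ->|y ->] /=; rewrite ?mulg1 ?invg1.
by move=> A [[]].
Qed.

Lemma identity_coset_subproof :
  special_subgroup e G finset.set0 \in @abelian_cosets V e G.
Proof.
apply/mem_set; exists 1, finset.set0; rewrite left_coset1; split=> //.
by rewrite special_subgroup0 => x y -> ->.
Qed.

(** The vertex {1} of the base chamber; its translate by [g] is {g}. *)
Definition identity_coset : @coset_poset V e G :=
  exist (fun A => A \in @abelian_cosets V e G) _ identity_coset_subproof.

End Chambers.

(** * Poset elements as points of the realization *)

Section Dirac.
Variables (R : realType) (d : Order.disp_t) (P : porderType d) (a : P).
Local Open Scope classical_set_scope.
Local Open Scope ring_scope.

Definition dirac_weight (p : P) : R := (p == a)%:R.

Lemma dirac_support : weight_support dirac_weight = [set a].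
Proof.
rewrite /weight_support /dirac_weight; apply/seteqP; split=> p /=.
  by case: (eqVneq p a) => //=; rewrite eqxx.
by move=> ->; rewrite eqxx GRing.oner_neq0.
Qed.

Lemma dirac_ge0 p : 0 <= dirac_weight p.
Proof. exact: Num.Theory.ler0n. Qed.

Lemma dirac_finite : finite_set (weight_support dirac_weight).
Proof. by rewrite dirac_support; apply: finite_set1. Qed.

Lemma dirac_chain :
  total_on (weight_support dirac_weight) (fun p q => (p <= q)%O).
Proof. by rewrite dirac_support => p q -> ->; left. Qed.

Lemma dirac_sum :
  \sum_(p \in weight_support dirac_weight) dirac_weight p = 1.
Proof. by rewrite dirac_support fsbig_set1 /dirac_weight eqxx. Qed.

Definition dirac_point : realization R P :=
  Realization dirac_ge0 dirac_finite dirac_chain dirac_sum.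

End Dirac.

(** * Distinct group elements give distinct chambers *)

Section Translates.
Variables (R : realType) (V : finType) (e : rel V) (G : V -> groupType).
Local Open Scope classical_set_scope.

Lemma translateK_inj : injective (translateK R e G).
Proof.
move=> g h gh; set A := identity_coset e G.
have : translateK R e G g (translate g (dirac_point R A)).
  exists (dirac_point R A) => //= p; rewrite /= dirac_support => ->.
  exists finset.set0; split=> //.
  by rewrite special_subgroup0 => x y -> ->.
(* Comparing weights at the vertex {g}, the preimage [x] in K has weight 1 at the translate of {g}
   by [h^-1], which is therefore a special subgroup. *)
rewrite gh => -[x Kx] /(congr1 (fun y => weight y (translate_coset g A))) /=.
rewrite /dirac_weight translate_cosetK eqxx => wx.
have /Kx[T [_]] : weight_support (weight x)
    (translate_coset h^-1 (translate_coset g A)).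
  by rewrite /weight_support /= wx GRing.oner_neq0.
rewrite /= => hgT.
(* This subgroup contains 1 but is the singleton of [h^-1 * g]. *)
have : special_subgroup e G T 1 by move=> B [[]].
rewrite -hgT special_subgroup0 => -[_ [_ -> <-]].
by rewrite mulg1 => /(canRL (mulVKg h)); rewrite mulg1.
Qed.

End Translates.

(** * Galleries as expressions, and the distance function *)

Section BuildingSystem.
Variables (R : realType) (V : finType) (e : rel V) (G : V -> groupType).
Hypotheses (e_sym : symmetric e) (e_irr : irreflexive e).
Local Open Scope classical_set_scope.
Local Notation GG := (graph_product e G).
Local Notation Phi := (building_system R e G).
Local Notation types := (map (@tag V G)).
Local Notation nontrivial := (all (predC (@trivial_letter V G))).

Lemma translateK_range g : translateK R e G g \in range (translateK R e G).
Proof. by apply/mem_set; exists g. Qed.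

Definition chamber_of (g : GG) : chamber Phi :=
  exist (fun C => C \in range (translateK R e G)) _ (translateK_range g).

Lemma chamber_of_inj : injective chamber_of.
Proof. by move=> g h /(congr1 val) /translateK_inj. Qed.

Lemma chamber_of_surj (C : chamber Phi) : exists g, C = chamber_of g.
Proof.
by case: C => C CK; have [g _ gC] := set_mem CK; exists g; apply: val_inj.
Qed.

(** Injectivity of [translateK] removes the choice of representatives from the definition of the
    equivalence. *)
Lemma chamber_equivP v g h :
  chamber_equiv v (chamber_of g) (chamber_of h) <->
  exists x : G v, h = g * gp_inj e x.
Proof.
split=> [[g' [h' [/= /translateK_inj-> /translateK_inj-> [x _ xE]]]]|[x ->]].
  by exists x; rewrite xE mulVKg.
by exists g, (g * gp_inj e x); split=> //; exists x; rewrite ?mulKg.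
Qed.

Lemma gp_inj1 v : gp_inj e (1 : G v) = 1.
Proof. by apply/gp_classP; apply: (GpStep [::] [::] (GpUnit e G v)). Qed.

Lemma gp_injM v (x y : G v) : gp_inj e (x * y) = gp_inj e x * gp_inj e y.
Proof.
rewrite [RHS]gp_class_mul; apply/gp_classP/GpSym.
exact: (GpStep [::] [::] (GpMul e x y)).
Qed.

Lemma gp_injV v (x : G v) : gp_inj e x^-1 = (gp_inj e x)^-1.
Proof. exact/esym/gp_class_inv. Qed.

(** A nontrivial syllable is a reduced word of length one, the empty word is reduced for 1, and
    swaps preserve length. *)
Lemma gp_inj_neq1 v (x : G v) : x != 1 -> gp_inj e x <> 1.
Proof.
move=> x1 /gp_classP xc.
have rx : reduced e [:: Tagged G x] by rewrite /reduced /= /trivial_letter x1.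
by have /shuffle_size := reduced_word_unique (u' := [::]) e_sym e_irr rx isT xc.
Qed.

Lemma chamber_adjacentP v g h :
  chamber_adjacent v (chamber_of g) (chamber_of h) <->
  exists2 x : G v, x != 1 & h = g * gp_inj e x.
Proof.
split=> [[/chamber_equivP[x hE] neq]|[x x1 hE]].
  by exists x => //; apply/eqP=> x1; apply: neq; rewrite hE x1 gp_inj1 mulg1.
split; first by apply/chamber_equivP; exists x.
move=> /chamber_of_inj gh; apply: (gp_inj_neq1 x1).
by apply: (mulgI g); rewrite mulg1 -hE.
Qed.

Lemma gallery_from_toP w g h :
  gallery_from_to w (chamber_of g) (chamber_of h) <->
  exists u, [/\ types u = w, nontrivial u & h = g * gp_class e u].
Proof.
split=> [[p]|[u [<- + ->]]].
  elim: w g p => [|v w IH] g [|C p] /=; [|by case|by case|].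
    by move=> [_ /chamber_of_inj <-]; exists [::]; split=> //; rewrite mulg1.
  have [k ->] := chamber_of_surj C.
  move=> [[/chamber_adjacentP[x x1 kE] wp] ph].
  have [u [<- u1 ->]] := IH _ _ (conj wp ph).
  exists (Tagged G x :: u); split=> //=; first by rewrite x1.
  by rewrite kE -mulgA; congr (_ * _); apply: gp_class_mul.
elim: u g => [|[v x] u IH] g /=; first by exists [::]; rewrite /= mulg1.
move=> /andP[x1 /(IH (g * gp_inj e x))[p [wp ph]]].
exists (chamber_of (g * gp_inj e x) :: p) => /=; split.
  by split=> //; apply/chamber_adjacentP; exists x.
rewrite ph -mulgA; congr (chamber_of (_ * _)).
exact: gp_class_mul.
Qed.

(** The word [repr a] is arbitrary; another choice alters this sequence only by swaps, hence not its
    value in [racg e]. *)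
Definition weyl_word (a : GG) : seq V := types (normal_form e (repr a)).

(** Left to right, [u] is reduced because [w] is, hence a shuffle of the normal form. Right to left,
    uniqueness in [racg e] gives a shuffle of types, which lifts to the syllables of the normal
    form. *)
Lemma nontrivial_expression w (a : GG) : reduced_word (racg_gen e) w ->
  (exists u, [/\ types u = w, nontrivial u & a = gp_class e u]) <->
  word_value (racg_gen e) (weyl_word a) = word_value (racg_gen e) w.
Proof.
move=> /(reduced_wordP e_sym e_irr) rw.
set n := normal_form e (repr a).
have rn : reduced e n by apply: reduced_normal_form.
have na : gp_class e n = a.
  by rewrite -[RHS]reprK; apply/gp_classP/congr_normal_form.
split=> [[u [uw u1 au]]|].
  have ru : reduced e u by rewrite /reduced u1 uw.
  have /(reduced_word_unique e_sym e_irr rn ru) : gp_congr e n u.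
    by apply/gp_classP; rewrite na.
  move=> nu; rewrite -uw; apply: shuffle_word_value.
  exact: (shuffle_map _ nu).
have /andP[n1 rtn] := rn.
move=> /(graph_reduced_shuffle e_sym e_irr rtn rw) /shuffle_types_lift.
move=> [u nu uw]; exists u; split=> //; first by rewrite -(shuffle_all _ nu).
by rewrite -na; apply/gp_classP/shuffle_congr.
Qed.

End BuildingSystem.

Theorem theorem2p4 (R : realType) (V : finType) (e : rel V)
    (e_sym : symmetric e) (e_irr : irreflexive e)
    (G : V -> groupType)
    (G_cyclic : forall v, cyclic_group (G v))
    (G_nontrivial : forall v, nontrivial_group (G v)) :
  right_angled_building e (building_system R e G).
Proof.
have surj := @chamber_of_surj R V e G.
have equiv_refl v (g : graph_product e G) :
    chamber_equiv v (chamber_of R g) (chamber_of R g).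
  by apply/chamber_equivP; exists 1; rewrite gp_inj1 mulg1.
split.
- move=> v; split.
  + by move=> C; have [g ->] := surj C.
  + move=> C D; have [g ->] := surj C; have [h ->] := surj D.
    move=> /chamber_equivP[x ->]; apply/chamber_equivP; exists x^-1.
    by rewrite gp_injV mulgK.
  + move=> B C D; have [g ->] := surj B; have [h ->] := surj C.
    have [k ->] := surj D; move=> /chamber_equivP[x ->] /chamber_equivP[y ->].
    by apply/chamber_equivP; exists (x * y); rewrite -mulgA gp_injM.
- move=> v C; have [g ->] := surj C; have [x /eqP x1] := G_nontrivial v.
  have [] : chamber_adjacent v (chamber_of R g) (chamber_of R (g * gp_inj e x)).
    by apply/chamber_adjacentP => //; exists x.
  by move=> gx neq; exists (chamber_of R g), (chamber_of R (g * gp_inj e x)).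
(* [f] recovers the unique group element of each chamber, so the distance can be read off from the
   quotient of two such elements. *)
- have [f fE] := choice surj.
  exists (fun C D =>
    word_value (racg_gen e) (weyl_word ((f C)^-1 * f D))).
  move=> w rw C D; rewrite -(nontrivial_expression e_sym e_irr _ rw).
  rewrite {1}(fE C) {1}(fE D) gallery_from_toP //.
  (* The same [u] serves both sides: the two equations differ by left multiplication by [f C]. *)
  split=> -[u [uw u1 uE]]; exists u; split=> //.
    by rewrite uE mulKg.
  by rewrite -uE mulVKg.
Qed.
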